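(* Let $p$ be an odd prime, let $\mathrm{w}=\begin{pmatrix}0&1\\-1&0\end{pmatrix}\in SL_2(\mathbb{F}_p)$, and let $T_{\mathrm{w}}=\{g\in SL_2(\mathbb{F}_p): g\mathrm{w}=\mathrm{w}g\}$ be its centralizer. Then $T_{\mathrm{w}}$ is a maximal torus in $SL_2(\mathbb{F}_p)$. Moreover, $T_{\mathrm{w}}$ is a split torus when $p\equiv1\pmod 4$ and is a non-split torus when $p\equiv3\pmod 4$.
   Context: A maximal torus in $SL_2(\mathbb{F}_p)$ means the group of $\mathbb{F}_p$-points of a maximal algebraic torus of $SL_2$ defined over $\mathbb{F}_p$. It is split if it is conjugate in $SL_2(\mathbb{F}_p)$ to $A=\{\mathrm{diag}(a,a^{-1}):a\in\mathbb{F}_p^\times\}$, and non-split otherwise; the non-split ones are exactly the images of the norm-one group $\{x\in\mathbb{F}_{p^2}^\times: N_{\mathbb{F}_{p^2}/\mathbb{F}_p}(x)=1\}$ under $\mathbb{F}_p$-algebra embeddings $\mathbb{F}_{p^2}\to M_2(\mathbb{F}_p)$. *)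

(* Defs.v *)
From HB Require Import structures.
From mathcomp Require Import all_boot all_order all_fingroup all_algebra all_field.
From mathcomp Require Import mpoly.

Set Implicit Arguments.
Unset Strict Implicit.
Unset Printing Implicit Defensive.

Import GRing.Theory.
Local Open Scope ring_scope.

(* A closed subscheme of SL_2 over k is presented by a set I of polynomials   *)
(* over k in the four matrix entries (taken in the row-major order of mxvec)  *)
(* and is identified with its functor of points R |-> SL2pt I R on            *)
(* commutative k-algebras.  By Yoneda, inclusions, equalities and             *)
(* isomorphisms of such group schemes are those of the functors.              *)
Definition equations (k : fieldType) := {mpoly k[2 * 2]} -> Prop.

Definition SL2pt (k : fieldType) (I : equations k) (R : comUnitAlgType k)
    (g : 'M[R]_2) : Prop :=
  \det g = 1 /\
  forall f, I f -> mmap (in_alg R) (fun i => mxvec g 0 i) f = 0.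

Definition algebraic_subgroup (k : fieldType) (I : equations k) : Prop :=
  forall R : comUnitAlgType k,
    [/\ SL2pt I (1%:M : 'M[R]_2),
        (forall g h : 'M[R]_2, SL2pt I g -> SL2pt I h -> SL2pt I (g *m h))
      & (forall g : 'M[R]_2, SL2pt I g -> SL2pt I (invmx g))].

Definition subscheme (k : fieldType) (I J : equations k) : Prop :=
  forall (R : comUnitAlgType k) (g : 'M[R]_2), SL2pt I g -> SL2pt J g.

(* phi R is only meaningful on the R-points of I, which it maps               *)
(* isomorphically, and naturally in R, onto the r-th power of the unit group. *)
Definition isomorphic_to_Gm_power (k : fieldType) (I : equations k) (r : nat)
    : Prop :=
  exists phi : forall R : comUnitAlgType k, 'M[R]_2 -> 'I_r -> R,
    [/\ forall (R : comUnitAlgType k) (g : 'M[R]_2), SL2pt I g ->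
          forall i, phi R g i \is a GRing.unit,
        forall (R : comUnitAlgType k) (g h : 'M[R]_2),
          SL2pt I g -> SL2pt I h ->
          forall i, phi R (g *m h) i = phi R g i * phi R h i,
        forall (R : comUnitAlgType k) (g h : 'M[R]_2),
          SL2pt I g -> SL2pt I h -> phi R g =1 phi R h -> g = h,
        forall (R : comUnitAlgType k) (u : 'I_r -> R),
          (forall i, u i \is a GRing.unit) ->
          exists2 g : 'M[R]_2, SL2pt I g & phi R g =1 u
      & forall (R S : comUnitAlgType k) (s : {lrmorphism R -> S})
          (g : 'M[R]_2), SL2pt I g ->
          forall i, phi S (map_mx s g) i = s (phi R g i)].

Definition base_change (k K : fieldType) (iota : {rmorphism k -> K})
    (I : equations k) : equations K :=
  fun f => exists2 f0, I f0 & f = map_mpoly iota f0.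

(* In the next two definitions iota is meant to be an algebraic closure of k. *)
Definition algebraic_torus (k K : fieldType) (iota : {rmorphism k -> K})
    (I : equations k) : Prop :=
  algebraic_subgroup I /\
  exists r, isomorphic_to_Gm_power (base_change iota I) r.

(* Maximality is geometric: it is tested over K, among all the tori of SL_2   *)
(* over K and not only among those defined over k.                            *)
Definition maximal_algebraic_torus (k K : fieldType)
    (iota : {rmorphism k -> K}) (I : equations k) : Prop :=
  algebraic_torus iota I /\
  forall J : equations K,
    algebraic_torus idfun J ->
    subscheme (base_change iota I) J -> subscheme J (base_change iota I).

Definition Fpbar (p : nat) : countClosedFieldType :=
  projT1 (countable_algebraic_closure 'F_p).

Definition Fp_to_Fpbar (p : nat) : {rmorphism 'F_p -> Fpbar p} :=
  sval (projT2 (countable_algebraic_closure 'F_p)).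

Definition mx22 (R : pzRingType) (a b c d : R) : 'M[R]_2 :=
  \matrix_(i, j) nth 0 (nth [::] [:: [:: a; b]; [:: c; d]] i) j.

Definition SL2 (p : nat) : {set {'GL_2['F_p]}} :=
  [set g : {'GL_2['F_p]} | \det (GLval g) == 1].

Definition diagonal_SL2 (p : nat) : {set {'GL_2['F_p]}} :=
  [set g : {'GL_2['F_p]} |
    [exists a : 'F_p, (a != 0) && (GLval g == mx22 a 0 0 a^-1)]].

Definition maximal_torus (p : nat) (T : {set {'GL_2['F_p]}}) : Prop :=
  exists2 I : equations 'F_p,
    maximal_algebraic_torus (Fp_to_Fpbar p) I
    & forall g : {'GL_2['F_p]},
        g \in T <-> SL2pt I (GLval g : 'M[('F_p)^o]_2).

Definition split_torus (p : nat) (T : {set {'GL_2['F_p]}}) : Prop :=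
  maximal_torus T /\
  exists2 x, x \in SL2 p & T = (diagonal_SL2 p :^ x)%g.

Definition nonsplit_torus (p : nat) (T : {set {'GL_2['F_p]}}) : Prop :=
  maximal_torus T /\
  ~ exists2 x, x \in SL2 p & T = (diagonal_SL2 p :^ x)%g.

Lemma w_unit (p : nat) : mx22 0 1 (-1) 0 \in @unitmx 'F_p 2.
Proof.
rewrite unitmxE (expand_det_row _ 0) !big_ord_recl big_ord0 /cofactor.
by rewrite !det_mx11 !mxE /= mul0r add0r addr0 mul1r mulrN1 unitrN unitrX ?unitrN1.
Qed.

Definition w (p : nat) : {'GL_2['F_p]} := Sub (mx22 0 1 (-1) 0) (w_unit p).

Definition T_w (p : nat) : {set {'GL_2['F_p]}} := ('C_(SL2 p)[w p])%g.

(* Main.v *)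
(* The centralizer of w in SL_2 consists of the matrices [[a, b], [-b, a]]     *)
(* with a^2 + b^2 = 1, which a square root i of -1 identifies with G_m through *)
(* a + i b.  A torus containing this group contains w and, being commutative,  *)
(* centralizes w: this is maximality.  The matrix w has eigenvalues i and -i,  *)
(* so the torus is diagonalizable over F_p exactly when -1 is a square in F_p. *)

Require Import Defs.
From mathcomp Require Import all_boot all_order all_fingroup all_algebra all_field.
From mathcomp Require Import mpoly ring.

Set Implicit Arguments.
Unset Strict Implicit.
Unset Printing Implicit Defensive.

Import GRing.Theory.

Section CentralizerOfW.
Local Open Scope ring_scope.

(** Commuting with [w] is a linear condition on the entries, so the group scheme can be handled on
    R-points, for all algebras R alike. [centralizer_w_Gm] rests on a^2 + b^2 = (a + ib)(a - ib):
    when i^2 = -1 and 2 is invertible, a + ib is a unit and serves as a coordinate on the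
    centralizer. [centralizer_w_maximal] adds [torus_comm]: a larger torus commutes with its own
    point [w], hence is no larger.

    Over F_p, splitness amounts to the existence of a square root of -1. Given one, [T_w_split]
    diagonalizes [w] by an explicit matrix of determinant 1; conversely [T_w_conj_diagonal] reads
    one off a diagonal conjugate of [w]. [finField_sqrtN1] and [Fp_no_sqrtN1] settle existence from
    p mod 4. *)

(** * Entrywise calculus of 2 by 2 matrices *)

Lemma eq_mx22 (R : pzRingType) (g h : 'M[R]_2) :
  g = h <-> [/\ g 0 0 = h 0 0, g 0 1 = h 0 1, g 1 0 = h 1 0 & g 1 1 = h 1 1].
Proof.
split=> [-> //|[e00 e01 e10 e11]]; apply/matrixP=> i j.
have ord2 (k : 'I_2) : k = 0 \/ k = 1.
  by case: k => [[|[|//]] kP]; [left | right]; apply: val_inj.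
by case: (ord2 i) => ->; case: (ord2 j) => ->.
Qed.

Lemma mulmx22E (R : pzRingType) (g h : 'M[R]_2) i j :
  (g *m h) i j = g i 0 * h 0 j + g i 1 * h 1 j.
Proof.
rewrite mxE !big_ord_recl big_ord0 addr0.
by congr (_ * _ + g i _ * h _ j); apply: val_inj.
Qed.

Lemma mx22E (R : pzRingType) (a b c d : R) :
  ((mx22 a b c d 0 0 = a) * (mx22 a b c d 0 1 = b) *
   (mx22 a b c d 1 0 = c) * (mx22 a b c d 1 1 = d))%type.
Proof. by rewrite !mxE. Qed.

Lemma det_mx22E (R : comPzRingType) (g : 'M[R]_2) :
  \det g = g 0 0 * g 1 1 - g 0 1 * g 1 0.
Proof.
rewrite (expand_det_row _ 0) !big_ord_recl big_ord0 /cofactor !det_mx11 !mxE.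
rewrite /= expr0 expr1 !mul1r addr0 mulN1r mulrN.
by congr (g _ _ * g _ _ - g _ _ * g _ _); apply: val_inj.
Qed.

Lemma comm_w (R : pzRingType) (g : 'M[R]_2) :
  g *m mx22 0 1 (-1) 0 = mx22 0 1 (-1) 0 *m g <->
  g 0 0 = g 1 1 /\ g 1 0 = - g 0 1.
Proof.
rewrite eq_mx22 !mulmx22E !mx22E.
rewrite !(mulr0, mul0r, mulr1, mul1r, addr0, add0r, mulrN1, mulN1r).
by split=> [[e1 e2 _ _]|[-> ->]].
Qed.

(** * The centralizer of [w] as an algebraic subgroup *)

(** The entries of gw = wg, as in [comm_w]; the equation det g = 1 is already part of [SL2pt]. *)
Definition centralizer_w_eqs (k : fieldType) : equations k := fun f =>
  f = 'X_(mxvec_index 0 0) - 'X_(mxvec_index 1 1) \/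
  f = 'X_(mxvec_index 1 0) + 'X_(mxvec_index 0 1).

Lemma SL2pt_centralizer_w (k : fieldType) (R : comUnitAlgType k) (g : 'M[R]_2) :
  SL2pt (@centralizer_w_eqs k) g <->
  \det g = 1 /\ g *m mx22 0 1 (-1) 0 = mx22 0 1 (-1) 0 *m g.
Proof.
rewrite comm_w; split=> -[dg Ig]; split=> //.
  split.
    have := Ig _ (or_introl erefl).
    by rewrite mmapB !mmapX !mmap1U !mxvecE => /subr0_eq.
  have := Ig _ (or_intror erefl).
  by rewrite mmapD !mmapX !mmap1U !mxvecE => /eqP; rewrite addr_eq0 => /eqP.
case: Ig => e1 e2 f [] ->.
  by rewrite mmapB !mmapX !mmap1U !mxvecE e1 subrr.
by rewrite mmapD !mmapX !mmap1U !mxvecE e2 addNr.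
Qed.

(** The coefficients are 1 and -1, which every field morphism fixes; geometric questions can thus be
    treated directly over K. *)
Lemma base_change_centralizer_w (k K : fieldType) (iota : {rmorphism k -> K}) f :
  base_change iota (@centralizer_w_eqs k) f <-> centralizer_w_eqs f.
Proof.
split=> [[_ [] -> ->]|[] ->].
- by left; rewrite rmorphB /= !map_mpolyX.
- by right; rewrite rmorphD /= !map_mpolyX.
- exists ('X_(mxvec_index 0 0) - 'X_(mxvec_index 1 1)); first by left.
  by rewrite rmorphB /= !map_mpolyX.
exists ('X_(mxvec_index 1 0) + 'X_(mxvec_index 0 1)); first by right.
by rewrite rmorphD /= !map_mpolyX.
Qed.

Lemma base_change_idfun (k : fieldType) (I : equations k) f :
  base_change idfun I f <-> I f.
Proof.
have map_id (g : {mpoly k[2 * 2]}) : map_mpoly idfun g = g.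
  by apply/mpolyP=> m; rewrite mcoeff_map_mpoly.
split=> [[g Ig ->]|If]; first by rewrite map_id.
by exists f; rewrite ?map_id.
Qed.

Lemma eq_SL2pt (k : fieldType) (I J : equations k) (R : comUnitAlgType k)
    (g : 'M[R]_2) :
  (forall f, I f <-> J f) -> SL2pt I g <-> SL2pt J g.
Proof. by move=> IJ; split=> -[? Ig]; split=> // f /IJ; apply: Ig. Qed.

Lemma centralizer_w_subgroup (k : fieldType) :
  algebraic_subgroup (@centralizer_w_eqs k).
Proof.
move=> R; split.
- by apply/SL2pt_centralizer_w; rewrite det1 mul1mx mulmx1.
- move=> g h /SL2pt_centralizer_w[dg cg] /SL2pt_centralizer_w[dh ch].
  apply/SL2pt_centralizer_w; split; first by rewrite det_mulmx dg dh mulr1.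
  by rewrite -mulmxA ch mulmxA cg mulmxA.
move=> g /SL2pt_centralizer_w[dg cg]; apply/SL2pt_centralizer_w.
have Ug : g \in unitmx by rewrite unitmxE dg unitr1.
split; first by rewrite det_inv dg invr1.
by rewrite -{1}[mx22 _ _ _ _](mulmxK Ug) -cg mulmxA mulKmx.
Qed.

(** * The centralizer as a maximal torus *)

Lemma centralizer_w_Gm (K : fieldType) (i : K) :
  i ^+ 2 = -1 -> (2 : K) != 0 ->
  isomorphic_to_Gm_power (@centralizer_w_eqs K) 1.
Proof.
move=> i2 K2.
have iA (R : comUnitAlgType K) : i%:A * i%:A = -1 :> R.
  by rewrite mulr_algl scalerA -expr2 i2 scaleN1r.
have hA (R : comUnitAlgType K) : 2 * (2^-1)%:A = 1 :> R.
  by rewrite mulr_natl -scaler_nat scalerA divff // scale1r.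
have ptP (R : comUnitAlgType K) (g : 'M[R]_2) :
    SL2pt (@centralizer_w_eqs K) g ->
    [/\ g 0 0 = g 1 1, g 1 0 = - g 0 1 &
        (g 0 0 + i%:A * g 0 1) * (g 0 0 - i%:A * g 0 1) = 1].
  case/SL2pt_centralizer_w => dg /comm_w[e1 e2]; split=> //.
  by rewrite -[RHS]dg det_mx22E -e1 e2; ring: (iA R).
have unitPt (R : comUnitAlgType K) (g : 'M[R]_2) :
    SL2pt (@centralizer_w_eqs K) g -> g 0 0 + i%:A * g 0 1 \is a GRing.unit.
  by case/ptP=> _ _ gK; apply/unitrPr; exists (g 0 0 - i%:A * g 0 1).
exists (fun R g _ => g 0 0 + i%:A * g 0 1); split.
- by move=> R g Ig _; apply: unitPt.
- move=> R g h /ptP[e1 e2 _] /ptP[e3 e4 _] _.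
  by rewrite !mulmx22E -e3 e4; ring: (iA R).
- move=> R g h Ig /ptP[h1 h2 hK] /(_ 0) /= e; have [g1 g2 gK] := ptP R g Ig.
  (* Here a - ib is the inverse of a + ib, so equal images have equal conjugates; [aE] and [bE] then
     recover a and b. *)
  have e' : g 0 0 - i%:A * g 0 1 = h 0 0 - i%:A * h 0 1.
    by apply: (mulrI (unitPt _ _ Ig)); rewrite gK e hK.
  have aE (a b : R) :
      a = (2^-1)%:A * ((a + i%:A * b) + (a - i%:A * b)) by ring: (hA R).
  have bE (a b : R) :
      b = - i%:A * (2^-1)%:A * ((a + i%:A * b) - (a - i%:A * b)).
    by ring: (hA R) (iA R).
  have ea : g 0 0 = h 0 0 by rewrite [LHS](aE _ (g 0 1)) [RHS](aE _ (h 0 1)) e e'.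
  have eb : g 0 1 = h 0 1 by rewrite [LHS](bE (g 0 0)) [RHS](bE (h 0 0)) e e'.
  by apply/eq_mx22; rewrite -g1 -h1 g2 h2 ea eb.
- move=> R u Uu; have [v uv] := unitrPr (Uu 0).
  (* The solution of a + ib = u, a - ib = v with v the inverse of u, using 1/i = -i. *)
  pose a := (2^-1)%:A * (u 0 + v); pose b := - i%:A * (2^-1)%:A * (u 0 - v).
  exists (mx22 a b (- b) a).
    apply/SL2pt_centralizer_w; rewrite comm_w det_mx22E !mx22E; split=> //.
    transitivity ((2 * (2^-1)%:A) * (2 * (2^-1)%:A) * (u 0 * v)).
      by rewrite /a /b; ring: (iA R).
    by rewrite hA uv !mul1r.
  by move=> j; rewrite !mx22E ord1 /a /b; ring: (iA R) (hA R).
move=> R S s g _ _; rewrite !mxE rmorphD rmorphM /=.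
by rewrite rmorph_alg.
Qed.

(** On R-points a torus over K embeds multiplicatively in a power of the units of R, which is
    commutative. *)
Lemma torus_comm (K : fieldType) (J : equations K) (R : comUnitAlgType K)
    (g h : 'M[R]_2) :
  algebraic_torus idfun J -> SL2pt J g -> SL2pt J h -> g *m h = h *m g.
Proof.
case=> Jgrp [r [phi [_ phiM phi_inj _ _]]] Jg Jh.
have [_ JM _] := Jgrp R.
have toJ (u : 'M[R]_2) : SL2pt J u -> SL2pt (base_change idfun J) u.
  by move=> Ju; apply/(eq_SL2pt _ (base_change_idfun J)).
apply: (phi_inj R); [exact/toJ/JM | exact/toJ/JM | move=> j].
rewrite (phiM R g h (toJ g Jg) (toJ h Jh)) (phiM R h g (toJ h Jh) (toJ g Jg)).
exact: mulrC.
Qed.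

Lemma centralizer_w_maximal (k : fieldType) (K : closedFieldType)
    (iota : {rmorphism k -> K}) :
  (2 : k) != 0 -> maximal_algebraic_torus iota (@centralizer_w_eqs k).
Proof.
move=> k2.
have K2 : (2 : K) != 0 by rewrite -(rmorph_nat iota) fmorph_eq0.
have bcE R g := @eq_SL2pt K _ _ R g (base_change_centralizer_w iota).
split.
  split; first exact: centralizer_w_subgroup.
  have [i i2] := imaginary_exists K; exists 1.
  have [phi [h1 h2 h3 h4 h5]] := centralizer_w_Gm i2 K2.
  exists phi; split=> [R g /bcE|R g h /bcE Ig /bcE|R g h /bcE Ig /bcE|R u Uu
    |R S s g /bcE]; [exact: h1 | exact: h2 | exact: h3 | | exact: h5].
  by have [g Ig phig] := h4 R u Uu; exists g => //; apply/bcE.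
move=> J tJ IJ R h Jh; apply/bcE/SL2pt_centralizer_w; split; first by case: Jh.
(* [w] lies in its own centralizer, hence in J, so every point of J commutes with it. *)
apply: (torus_comm tJ Jh); apply/IJ/bcE/SL2pt_centralizer_w; split=> //.
by rewrite det_mx22E !mx22E; ring.
Qed.

(** * The group of F_p-points *)

Lemma Fp_two_neq0 (p : nat) : prime p -> odd p -> (2 : 'F_p) != 0.
Proof.
move=> p_pr p_odd; rewrite -(dvdn_pcharf (pchar_Fp p_pr)) dvdn_prime2 //.
by apply: contraL p_odd => /eqP->.
Qed.

Lemma mem_T_w (p : nat) (g : {'GL_2['F_p]}) :
  g \in T_w p <-> \det (GLval g) = 1 /\
    GLval g *m mx22 0 1 (-1) 0 = mx22 0 1 (-1) 0 *m GLval g.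
Proof.
rewrite in_setI inE; split=> [/andP[/eqP dg /cent1P cg]|[-> cg]].
  by split=> //; apply: (congr1 GLval cg).
by rewrite eqxx; apply/cent1P/val_inj.
Qed.

Lemma T_w_maximal (p : nat) : prime p -> odd p -> maximal_torus (T_w p).
Proof.
move=> p_pr p_odd; exists (@centralizer_w_eqs 'F_p).
  exact/centralizer_w_maximal/Fp_two_neq0.
by move=> g; rewrite mem_T_w SL2pt_centralizer_w.
Qed.

(** * Square roots of -1 in finite fields *)

(** If F has 4n + 1 elements, X^(2n) - 1 has too few roots to vanish at all 4n units. A unit x off
    its roots has x^(4n) = 1, so x^(2n) = -1 and x^n is the required root. *)
Lemma finField_sqrtN1 (F : finFieldType) :
  #|F| = 1 %[mod 4] -> exists i : F, i ^+ 2 = -1.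
Proof.
move=> F4; pose n := (#|F| %/ 4)%N.
have Fn : #|F| = (n * 4).+1 by rewrite (divn_eq #|F| 4) F4 addn1.
have n_gt0 : (0 < n)%N by have := finNzRing_gt1 F; rewrite Fn; case: (n).
pose q : {poly F} := 'X^(n * 2) - 1.
have size_q : size q = (n * 2).+1 by rewrite size_XnsubC // muln_gt0 n_gt0.
have [x x0 xq] : exists2 x : F, x != 0 & ~~ root q x.
  apply/exists_inP; rewrite -negb_forall_in; apply/negP => /forall_inP qx.
  suff : (n * 4 < (n * 2).+1)%N by rewrite ltnS leq_pmul2l.
  have <- : #|predC1 (0 : F)| = (n * 4)%N by rewrite cardC1 Fn.
  rewrite -size_q cardE.
  apply: max_poly_roots; rewrite ?enum_uniq -?size_poly_eq0 ?size_q //.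
  by apply/allP=> x; rewrite mem_enum; apply: qx.
have x4 : x ^+ (n * 4) = 1.
  by apply: (mulfI x0); rewrite -exprS -Fn expf_card mulr1.
exists (x ^+ n); apply/eqP; rewrite -exprM -addr_eq0.
have : (x ^+ (n * 2) - 1) * (x ^+ (n * 2) + 1) = 0.
  by rewrite -subr_sqr expr1n -exprM -mulnA x4 subrr.
move/eqP; rewrite mulf_eq0 => /orP[q0|//]; case/negP: xq.
by rewrite /root !hornerE.
Qed.

Lemma Fp_sqrtN1 (p : nat) : prime p -> p = 1 %[mod 4] ->
  exists i : 'F_p, i ^+ 2 = -1.
Proof. by move=> p_pr p4; apply: finField_sqrtN1; rewrite card_Fp. Qed.

(** If i^2 = -1 and p = 3 + 4m, then i^p = i^3 = -i, while Fermat gives i^p = i; hence 2i = 0 and i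
    = 0, which is absurd. *)
Lemma Fp_no_sqrtN1 (p : nat) (i : 'F_p) : odd p -> prime p -> p = 3 %[mod 4] ->
  i ^+ 2 <> -1.
Proof.
move=> p_odd p_pr p4 i2; have p2 := Fp_two_neq0 p_pr p_odd.
have pE : p = (3 + 2 * 2 * (p %/ 4))%N by rewrite {1}(divn_eq p 4) p4 addnC mulnC.
have := expf_card i; rewrite card_Fp // (congr1 (GRing.exp i) pE).
rewrite exprD 2!exprM i2 sqrrN !expr1n mulr1 exprS i2 => /eqP.
rewrite mulrN1 eq_sym -addr_eq0 -mulr2n -mulr_natl mulf_eq0 (negPf p2) /=.
by move/eqP => i0; move/eqP: i2; rewrite i0 expr0n eq_sym oppr_eq0 oner_eq0.
Qed.

(** * Conjugacy with the diagonal torus *)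

Lemma T_w_split (p : nat) (i : 'F_p) : (2 : 'F_p) != 0 -> i ^+ 2 = -1 ->
  exists2 x, x \in SL2 p & T_w p = (diagonal_SL2 p :^ x)%g.
Proof.
move=> p2 i2.
have i0 : i != 0.
  apply/eqP=> i0; move/eqP: i2.
  by rewrite i0 expr0n eq_sym oppr_eq0 oner_eq0.
pose s := (2 * i)^-1.
have sE : 2 * i * s = 1 by rewrite divff // mulf_neq0.
(* The rows are left eigenvectors of [w] for i and -i; the factor [s] brings the determinant to
   1. *)
pose X := mx22 1 (- i) s (s * i).
have dX : \det X = 1 by rewrite det_mx22E !mx22E; ring: sE.
have UX : X \in unitmx by rewrite unitmxE dX unitr1.
pose x : {'GL_2['F_p]} := Sub X UX.
have xP : GLval x = X by [].
exists x; first by rewrite inE xP dX.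
apply/setP=> g; rewrite mem_conjg.
set h := (g ^ x^-1)%g.
have gE : X *m GLval g = GLval h *m X.
  by rewrite -xP -!GL_MxE /h conjgE invgK -mulgA -mulgA mulVg mulg1.
clearbody h.
have dg : \det (GLval g) = \det (GLval h).
  by have := congr1 (fun M => \det M) gE; rewrite !det_mulmx dX mul1r mulr1.
have XW : X *m mx22 0 1 (-1) 0 = mx22 i 0 0 (- i) *m X.
  by apply/eq_mx22; rewrite !mulmx22E !mx22E; split; ring: i2.
apply/idP/idP.
  move=> /mem_T_w; rewrite dg => -[dh cg].
  have ch : GLval h *m mx22 i 0 0 (- i) = mx22 i 0 0 (- i) *m GLval h.
    apply: (can_inj (mulmxK UX)).
    rewrite -[LHS]mulmxA -XW [LHS]mulmxA -gE -[LHS]mulmxA cg.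
    by rewrite [LHS]mulmxA XW -[LHS]mulmxA gE mulmxA.
  move/eq_mx22: ch; rewrite !mulmx22E !mx22E => -[_ e01 e10 _].
  (* The eigenvalues i and -i differ by 2i, which is nonzero, so a matrix commuting with diag(i, -i)
     has zero off-diagonal entries. *)
  have i20 : 2 * i != 0 by rewrite mulf_neq0.
  have h01 : GLval h 0 1 = 0.
    apply: (mulfI i20); rewrite mulr0; apply/eqP.
    rewrite -mulrA mulr_natl mulr2n addr_eq0; apply/eqP.
    by move: e01; rewrite mulr0 add0r mul0r addr0 mulrN mulrC => ->.
  have h10 : GLval h 1 0 = 0.
    apply: (mulfI i20); rewrite mulr0; apply/eqP.
    rewrite -mulrA mulr_natl mulr2n addr_eq0; apply/eqP.
    by move: e10; rewrite mulr0 mul0r addr0 add0r mulNr mulrC.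
  have dh1 : GLval h 0 0 * GLval h 1 1 = 1.
    by rewrite -[RHS]dh det_mx22E h01 mul0r subr0.
  have h0 : GLval h 0 0 != 0.
    by apply/eqP=> h0; move/eqP: dh1; rewrite h0 mul0r eq_sym oner_eq0.
  rewrite inE; apply/exists_inP; exists (GLval h 0 0) => //.
  apply/eqP/eq_mx22; rewrite !mx22E; split=> //.
  by apply: (mulfI h0); rewrite dh1 divff.
rewrite inE => /exists_inP[a a0 /eqP hE]; apply/mem_T_w; rewrite dg hE.
split; first by rewrite det_mx22E !mx22E mul0r subr0 divff.
apply: (can_inj (mulKmx UX)).
rewrite [LHS]mulmxA gE -[LHS]mulmxA XW [RHS]mulmxA XW -[RHS]mulmxA gE hE.
rewrite [LHS]mulmxA [RHS]mulmxA; congr (_ *m _).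
by apply/eq_mx22; rewrite !mulmx22E !mx22E; split; ring.
Qed.

(** Since [w] lies in [T_w], its conjugate by [x] is some diag(a, 1/a). From w^2 = -1, a scalar
    fixed by conjugation, the upper left entry gives a^2 = -1. *)
Lemma T_w_conj_diagonal (p : nat) (x : {'GL_2['F_p]}) :
  T_w p = (diagonal_SL2 p :^ x)%g -> exists i : 'F_p, i ^+ 2 = -1.
Proof.
move=> Tx; have : w p \in T_w p.
  by apply/mem_T_w; split=> //; rewrite det_mx22E !mx22E; ring.
rewrite Tx mem_conjg inE => /exists_inP[a _ /eqP wa]; exists a.
have /eq_mx22[+ _ _ _] :
    GLval ((w p ^ x^-1) * (w p ^ x^-1))%g = (- 1)%:M :> 'M['F_p]_2.
  have ww : GLval (w p * w p)%g = (- 1)%:M :> 'M['F_p]_2.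
    rewrite GL_MxE; apply/eq_mx22; rewrite !mulmx22E !mx22E !mxE /=.
    by split; ring.
  rewrite -conjMg conjgE invgK 2!GL_MxE ww mul_scalar_mx -scalemxAr -GL_MxE.
  by rewrite mulgV scalemx1.
by rewrite GL_MxE wa mulmx22E !mx22E !mxE mul0r addr0 expr2.
Qed.

End CentralizerOfW.

Theorem proposition1 (p : nat) (p_pr : prime p) (p_odd : odd p) :
  maximal_torus (T_w p) /\
  (p = 1 %[mod 4] -> split_torus (T_w p)) /\
  (p = 3 %[mod 4] -> nonsplit_torus (T_w p)).
Proof.
have max := T_w_maximal p_pr p_odd; split=> //; split=> p4; split=> //.
  have [i i2] := Fp_sqrtN1 p_pr p4.
  exact: T_w_split (Fp_two_neq0 p_pr p_odd) i2.
by case=> x _ /T_w_conj_diagonal[i]; apply: Fp_no_sqrtN1 p_odd p_pr p4.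
Qed.
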